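(* Let $G$ be a finite group with $\kappa(\mathcal{G}(G))=\delta(\mathcal{G}(G))$. Suppose $G$ is not a cyclic group of prime power order, and let $v\in G$ satisfy $\deg(v)=\delta(\mathcal{G}(G))$. Then: (i) $N(v)$ is a minimum separating set of $\mathcal{G}(G)$; (ii) $v$ has order $2$ in $G$; consequently $|G|$ is even.
   Context: The power graph $\mathcal{G}(G)$ has vertex set $G$, distinct $u,v$ adjacent iff one is a positive integer power of the other. $\delta$ is minimum degree, $N(v)$ is the set of neighbours of $v$. $\kappa(\Gamma)$ is the (vertex) connectivity: the minimum number of vertices whose removal results in a disconnected or trivial graph. A separating set is a set of vertices whose removal increases the number of components; a minimum separating set is one of least cardinality. *)

(* Defs.v *)
From HB Require Import structures.
From mathcomp Require Import all_boot all_fingroup all_solvable.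

Set Implicit Arguments.
Unset Strict Implicit.
Unset Printing Implicit Defensive.

(* Simple graphs whose vertex set is a subset of a finite type. *)
Record sgraph (T : finType) := SGraph {
  vertices : {set T};
  adj : rel T;
  adj_vertices : forall x y, adj x y -> x \in vertices;
  adj_sym : symmetric adj;
  adj_irrefl : irreflexive adj }.

Section Graph.
Variables (T : finType) (Gam : sgraph T).
Implicit Types (S : {set T}) (v : T).

Definition neighbours v : {set T} := [set w in vertices Gam | adj Gam v w].

Definition degree v : nat := #|neighbours v|.

(* The default value #|vertices Gam| exceeds every degree, so it is only
   reached on the graph without vertices. *)
Definition min_degree : nat :=
  \big[minn/#|vertices Gam|]_(v in vertices Gam) degree v.

Definition num_components : nat := n_comp (adj Gam) (vertices Gam).

Definition disconnected : bool := 1 < num_components.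

Definition trivial_graph : bool := #|vertices Gam| == 1.

Definition remove_adj S : rel T :=
  [rel x y | [&& x \notin S, y \notin S & adj Gam x y]].

Fact remove_adj_vertices S x y :
  remove_adj S x y -> x \in vertices Gam :\: S.
Proof. by case/and3P=> xS _ /adj_vertices xV; rewrite inE xS. Qed.

Fact remove_adj_sym S : symmetric (remove_adj S).
Proof. by move=> x y; rewrite /remove_adj /= adj_sym andbCA. Qed.

Fact remove_adj_irrefl S : irreflexive (remove_adj S).
Proof. by move=> x; rewrite /remove_adj /= adj_irrefl !andbF. Qed.

Definition remove_vertices S : sgraph T :=
  SGraph (@remove_adj_vertices S) (remove_adj_sym S) (remove_adj_irrefl S).

End Graph.

Section Connectivity.
Variables (T : finType) (Gam : sgraph T).
Implicit Types S : {set T}.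

(* Removing all vertices but one leaves a trivial graph, so the default value
   #|vertices Gam| is only reached on the graph without vertices. *)
Definition connectivity : nat :=
  \big[minn/#|vertices Gam|]_(S : {set T} | (S \subset vertices Gam) &&
      (disconnected (remove_vertices Gam S)
       || trivial_graph (remove_vertices Gam S))) #|S|.

Definition separating_set S : Prop :=
  S \subset vertices Gam /\
  num_components Gam < num_components (remove_vertices Gam S).

Definition minimum_separating_set S : Prop :=
  separating_set S /\ forall S', separating_set S' -> #|S| <= #|S'|.

End Connectivity.

Section PowerGraph.
Variable gT : finGroupType.
Implicit Types (x y : gT) (G : {group gT}).

(* The exponents 1, ..., #[x] give all the positive powers of x. *)
Definition is_pos_power x y : bool := [exists n : 'I_#[x], y == x ^+ n.+1]%g.

Lemma is_pos_powerP x y :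
  reflect (exists n, 0 < n /\ y = x ^+ n)%g (is_pos_power x y).
Proof.
apply: (iffP existsP) => [[n /eqP->]|[[|n] [] // _ ->]]; first by exists n.+1.
exists (Ordinal (ltn_pmod n (order_gt0 x))).
by rewrite /= !expgS expg_mod_order.
Qed.

Definition power_adj G : rel gT :=
  [rel x y | [&& x \in G, y \in G, x != y & is_pos_power x y || is_pos_power y x]].

Fact power_adj_vertices G x y : power_adj G x y -> x \in (G : {set gT}).
Proof. by case/andP. Qed.

Fact power_adj_sym G : symmetric (power_adj G).
Proof. by move=> x y; rewrite /power_adj /= andbCA eq_sym orbC. Qed.

Fact power_adj_irrefl G : irreflexive (power_adj G).
Proof. by move=> x; rewrite /power_adj /= eqxx !andbF. Qed.

Definition power_graph G : sgraph gT :=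
  SGraph (@power_adj_vertices G) (@power_adj_sym G) (@power_adj_irrefl G).

End PowerGraph.

(* Main.v *)
Require Import Defs.
From HB Require Import structures.
From mathcomp Require Import all_boot all_fingroup all_solvable.

Set Implicit Arguments.
Unset Strict Implicit.
Unset Printing Implicit Defensive.

(** A complete power graph belongs to a cyclic group of prime power order, so
    here some [w != v] is not adjacent to [v]: removing [N(v)] isolates [v] from
    [w], and [kappa = delta] makes [N(v)] a minimum separating set.  If [v] were
    not an involution then [v^-1 != v] would have the same closed neighbourhood
    as [v], so the smaller set [N(v) \ {v^-1}] would already separate
    [{v, v^-1}] from [w]. *)

Lemma leq_bigminn (I : eqType) (r : seq I) (P : pred I) (F : I -> nat) m i :
  i \in r -> P i -> \big[minn/m]_(j <- r | P j) F j <= F i.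
Proof.
elim: r => // j r IHr; rewrite inE big_cons => /predU1P[<- -> | ir Pi].
  exact: geq_minl.
by case: ifP => _; rewrite ?geq_min IHr ?orbT.
Qed.

Section SimpleGraph.
Variables (T : finType) (Gam : sgraph T).
Implicit Types x y : T.

Lemma adj_verticesr x y : adj Gam x y -> y \in vertices Gam.
Proof. by rewrite adj_sym; apply: adj_vertices. Qed.

Lemma closed_vertices : closed (adj Gam) (vertices Gam).
Proof.
by move=> x y xy; rewrite (adj_vertices xy) (adj_verticesr xy).
Qed.

Lemma adj_connect_sym : connect_sym (adj Gam).
Proof. exact: sym_connect_sym (@adj_sym T Gam). Qed.

(** [n_comp] counts roots of components. The roots of [x] and [y] differ, and both stay in the
    vertex set because it is closed under adjacency. *)
Lemma not_connect_disconnected x y :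
    x \in vertices Gam -> y \in vertices Gam -> ~~ connect (adj Gam) x y ->
  disconnected Gam.
Proof.
move=> xV yV nxy; apply/card_gt1P.
exists (root (adj Gam) x), (root (adj Gam) y).
have rootV z : z \in vertices Gam ->
    root (adj Gam) z \in [predI roots (adj Gam) & vertices Gam].
  move=> zV; rewrite !inE roots_root; last exact: adj_connect_sym.
  by rewrite -(closed_connect closed_vertices (connect_root _ z)).
split; [exact: rootV | exact: rootV |].
by rewrite root_connect //; apply: adj_connect_sym.
Qed.

End SimpleGraph.

Section Removal.
Variables (T : finType) (Gam : sgraph T).
Implicit Types (A S : {set T}) (u v w x y : T).

Lemma num_components_universal u :
    u \in vertices Gam ->
    {in vertices Gam, forall x, x != u -> adj Gam u x} ->
  num_components Gam = 1.
Proof.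
move=> uV uadj; rewrite -(n_comp_connect (adj_connect_sym Gam) u).
apply: eq_n_comp_r => x; apply/idP/idP => [xV | ux].
  have [-> | xu] := eqVneq x u; first exact: connect0.
  exact/connect1/uadj.
by rewrite -(closed_connect (closed_vertices (Gam := Gam)) ux).
Qed.

(** Once [S] is deleted, no edge leaves [A], so [A] is closed under adjacency and no path joins [x]
    in [A] to [w] outside it. *)
Lemma remove_boundary_disconnected A S x w :
    x \in vertices Gam -> x \in A -> x \notin S ->
    w \in vertices Gam -> w \notin A -> w \notin S ->
    (forall y z, y \in A -> adj Gam y z -> z \in A :|: S) ->
  disconnected (remove_vertices Gam S).
Proof.
move=> xV xA xS wV wA wS bdA.
apply: (@not_connect_disconnected _ _ x w); rewrite ?inE ?xS ?wS //.
apply: contra wA => xw.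
suffices clA : closed (adj (remove_vertices Gam S)) A.
  by rewrite -(closed_connect clA xw).
apply: intro_closed => [|y z]; first exact: adj_connect_sym.
case/and3P=> _ zS yz yA; have := bdA y z yA yz.
by rewrite inE (negPf zS) orbF.
Qed.

Lemma min_degree_leq x : x \in vertices Gam -> min_degree Gam <= degree Gam x.
Proof. by move=> xV; apply: leq_bigminn; rewrite ?mem_index_enum. Qed.

Lemma connectivity_leq S :
    S \subset vertices Gam -> disconnected (remove_vertices Gam S) ->
  connectivity Gam <= #|S|.
Proof.
by move=> SV dS; apply: leq_bigminn; rewrite ?mem_index_enum // SV dS.
Qed.

Lemma neighbours_sub x : neighbours Gam x \subset vertices Gam :\ x.
Proof.
apply/subsetP=> y; rewrite !inE => /andP[-> xy]; rewrite andbT.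
by apply: contraTneq xy => ->; rewrite adj_irrefl.
Qed.

(** A non-adjacent pair forces [degree x] below [#|V| - 1], hence also the minimum degree; a vertex
    attaining it cannot be adjacent to all others. *)
Lemma min_degree_nonadjacent v :
    degree Gam v = min_degree Gam ->
    (exists x y, [/\ x \in vertices Gam, y \in vertices Gam, x != y
                   & ~~ adj Gam x y]) ->
    v \in vertices Gam ->
  exists w, [/\ w \in vertices Gam, w != v & ~~ adj Gam v w].
Proof.
move=> dv [x [y [xV yV neq_xy nxy]]] vV.
have : degree Gam v < #|vertices Gam :\ v|.
  rewrite dv (leq_ltn_trans (min_degree_leq xV)) //.
  have -> : #|vertices Gam :\ v| = #|vertices Gam :\ x|.
    have := cardsD1 v (vertices Gam); rewrite (cardsD1 x) xV vV.
    by move/addnI.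
  apply: proper_card; apply/properP; split; first exact: neighbours_sub.
  by exists y; rewrite !inE ?(negPf nxy) ?andbF // eq_sym neq_xy.
rewrite ltnNge; have [sub /negP[] | /subsetPn[w]] :=
  boolP (vertices Gam :\ v \subset neighbours Gam v); first exact: subset_leq_card.
by rewrite !inE => /andP[wv wV]; rewrite wV => nvw _; exists w.
Qed.

End Removal.

Section PowerGraphTheory.
Variable gT : finGroupType.
Implicit Types (G : {group gT}) (x y : gT).
Local Open Scope group_scope.

Lemma is_pos_powerE x y : is_pos_power x y = (y \in <[x]>).
Proof.
apply/is_pos_powerP/cycleP => [[n [_ ->]] | [n ->]]; first by exists n.
(* Adding the order makes the exponent positive without changing the power. *)
exists (#[x] + n)%N; split; first by rewrite addn_gt0 order_gt0.
by rewrite expgD expg_order mul1g.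
Qed.

Lemma power_graph_adjE G x y :
  adj (power_graph G) x y =
    [&& x \in G, y \in G, x != y & (y \in <[x]>) || (x \in <[y]>)].
Proof. by rewrite -!is_pos_powerE. Qed.

(** An element [x] of maximal order generates: if [x] lies in [<[y]>], maximality forces [<[x]> =
    <[y]>]. *)
Lemma comparable_cycles_cyclic G :
    {in G &, forall x y, (y \in <[x]>) || (x \in <[y]>)} -> cyclic G.
Proof.
move=> cmpG; have [x xG maxx] := @arg_maxnP _ 1 (mem G) (fun x => #[x]) (group1 G).
apply/cyclicP; exists x; apply/eqP; rewrite eqEsubset cycle_subG andbC [_ \in _]xG.
apply/subsetP=> y yG; have /orP[// | xy] := cmpG x y xG yG.
suffices /eqP-> : <[x]> == <[y]> by apply: cycle_id.
by rewrite eqEcard cycle_subG xy; apply: maxx.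
Qed.

(** Cauchy gives elements of order [p] and [q] for primes dividing [#|G|]; comparability makes one
    prime divide the other, so they coincide. *)
Lemma comparable_cycles_prime_power G :
    {in G &, forall x y, (y \in <[x]>) || (x \in <[y]>)} ->
  exists p k : nat, prime p /\ #|G| = (p ^ k)%N.
Proof.
(* The trivial group has order [2 ^ 0]. *)
move=> cmpG; have [G1 | ntG] := eqVneq (#|G|) 1%N; first by exists 2, 0.
have gt1G : 1 < #|G| by rewrite ltn_neqAle eq_sym ntG cardG_gt0.
pose p := pdiv #|G|; have pr_p : prime p := pdiv_prime gt1G.
suffices /card_pgroup-> : p.-group G by exists p, (logn p #|G|).
apply/pgroupP=> q pr_q q_dv_G.
have [a aG oa] := Cauchy pr_p (pdiv_dvd #|G|).
have [b bG ob] := Cauchy pr_q q_dv_G.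
have /orP[/order_dvdG | /order_dvdG] := cmpG a b aG bG.
  by rewrite -/(order a) oa ob dvdn_prime2.
by rewrite -/(order b) oa ob dvdn_prime2 // inE eq_sym.
Qed.

Lemma power_graph_not_complete G :
    ~ (cyclic G /\ exists p k : nat, prime p /\ #|G| = (p ^ k)%N) ->
  exists x y, [/\ x \in G, y \in G, x != y & ~~ adj (power_graph G) x y].
Proof.
move=> nG.
have [/exists_inP[x xG /exists_inP[y yG /andP[nxy nadj]]] | ncmp] :=
    boolP [exists x in G, exists y in G, (x != y) && ~~ adj (power_graph G) x y].
  by exists x, y.
suffices cmpG : {in G &, forall x y, (y \in <[x]>) || (x \in <[y]>)}.
  case: nG; split; first exact: comparable_cycles_cyclic.
  exact: comparable_cycles_prime_power.
move=> x y xG yG; have [-> | nxy] := eqVneq x y; first by rewrite cycle_id.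
move: ncmp; rewrite negb_exists_in => /forall_inP/(_ x xG).
rewrite negb_exists_in => /forall_inP/(_ y yG).
by rewrite nxy negbK power_graph_adjE => /and4P[].
Qed.

Lemma power_graph_adj1 G x : x \in G -> x != 1 -> adj (power_graph G) 1 x.
Proof. by move=> xG x1; rewrite power_graph_adjE !group1 xG eq_sym x1 orbT. Qed.

(** The identity is adjacent to every other vertex. Thus a set separates exactly when its removal
    leaves a [disconnected] graph. *)
Lemma num_components_power_graph G : num_components (power_graph G) = 1%N.
Proof.
by apply: (@num_components_universal _ (power_graph G) 1) => [|x];
  [apply: group1 | apply: power_graph_adj1].
Qed.

(** [x] and [x^-1] generate the same cyclic subgroup; only the case [y = x] has to be excluded
    separately. *)
Lemma power_graph_adjV G x y :
  y != x -> adj (power_graph G) x^-1 y -> adj (power_graph G) x y.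
Proof.
by rewrite !power_graph_adjE !groupV cycleV eq_sym => -> /and4P[-> -> _ ->].
Qed.

End PowerGraphTheory.

Theorem theorem6p2 (gT : finGroupType) (G : {group gT}) (v : gT)
    (hkappa : connectivity (power_graph G) = min_degree (power_graph G))
    (hG : ~ (cyclic G /\ exists p k : nat, prime p /\ #|G| = p ^ k))
    (hv : v \in G)
    (hdeg : degree (power_graph G) v = min_degree (power_graph G)) :
  minimum_separating_set (power_graph G) (neighbours (power_graph G) v) /\
  (#[v]%g = 2 /\ 2 %| #|G|).
Proof.
set Gam := power_graph G in hkappa hdeg *.
have [w [wG wv nvw]] :=
  min_degree_nonadjacent hdeg (power_graph_not_complete hG) hv.
have vN : v \notin neighbours Gam v by rewrite inE adj_irrefl andbF.
have wN : w \notin neighbours Gam v by rewrite inE (negPf nvw) andbF.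
have NG : neighbours Gam v \subset vertices Gam.
  exact: subset_trans (neighbours_sub _ _) (subsetDl _ _).
have NvP z : adj Gam v z -> z \in neighbours Gam v.
  by move=> vz; rewrite inE (adj_verticesr vz).
split.
  split=> [|S []]; rewrite /separating_set num_components_power_graph.
    split=> //; apply: (@remove_boundary_disconnected _ _ [set v] _ v w);
      rewrite ?in_set1 // => y z /set1P-> /NvP.
    by rewrite in_setU orbC => ->.
  (* Any separating set has at least [kappa = delta = degree v] elements. *)
  by move=> SG /(connectivity_leq SG); rewrite hkappa -hdeg.
suffices ov : #[v]%g = 2 by split; rewrite // -ov order_dvdG.
(* The identity would be adjacent to [w]. *)
have v1 : v != 1%g.
  apply: contraNneq nvw => v1; rewrite v1.
  by apply: power_graph_adj1; rewrite // -v1.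
have [vV | nvV] := eqVneq (v^-1)%g v.
  by apply: nt_prime_order; rewrite // expgS expg1 -{1}vV mulVg.
have vVN : (v^-1)%g \in neighbours Gam v.
  by apply: NvP; rewrite power_graph_adjE groupV hv eq_sym nvV groupV cycle_id.
pose S := neighbours Gam v :\ (v^-1)%g.
have/connectivity_leq : S \subset vertices Gam by apply: subset_trans (subsetDl _ _) NG.
have ltS : #|S| < degree Gam v by rewrite /degree (cardsD1 (v^-1)%g (neighbours Gam v)) vVN.
(* If [S] disconnected the graph, [kappa] would be below [degree v]; it remains to show that it
   does. *)
rewrite hkappa -hdeg leqNgt ltS; case/(_ _)/negP => //.
apply: (@remove_boundary_disconnected _ _ [set v; (v^-1)%g] _ v w) => //.
- by rewrite set21.
- by rewrite inE (negPf vN) andbF.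
- rewrite !inE (negPf wv); apply: contraNneq wN => ->; exact: vVN.
- by rewrite inE (negPf wN) andbF.
(* A neighbour of [v] or [v^-1] outside this pair is a neighbour of [v], hence lies in [S]. *)
move=> y z yA yz; rewrite in_setU in_set2 in_setD1.
have [//| zv] := eqVneq z v; have [//| zvV /=] := eqVneq z (v^-1)%g.
apply: NvP; case/set2P: yA yz => -> //.
exact: power_graph_adjV.
Qed.
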